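(* Let $V$ be a finite set of nodes with metric edge weights $c$. Let $T$ be a minimum spanning tree on $V$. Let $V_b \cup V_r = V$ be any 2-coloring of $V$, and let $T_b$ and $T_r$ be minimum spanning trees of $V_b$ and $V_r$, respectively. Let $e_\times=\{v_L,v_R\}$ be a heaviest edge of $T$, with weight $w_\times$. Let $T_L,T_R$ be the trees (on node sets $V_L,V_R$, respectively) obtained by deleting $e_\times$ from $T$, where $v_L\in T_L$ and $v_R\in T_R$. Let $w_L,w_R$ be the heaviest edge weights appearing in $T_L,T_R$, respectively. Then (a) $c(T_b)+c(T_r) \le 3c(T)-(w_L+w_\times+w_R)$, and (b) $\max\{c(T_b),c(T_r)\} \le 2c(T)-(w_L+w_\times+w_R)$. Moreover, if all nodes of $T_L$ are blue (i.e., $V_L\subseteq V_b$), then (c) $c(T_b)+c(T_r) \le c(T_L)+w_\times+(3c(T_R)-w_R)$, and (d) $\max\{c(T_b),c(T_r)\} \le c(T_L)+w_\times+(2c(T_R)-w_R)$.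
   Context: The weight function $c$ is defined on all pairs of nodes (complete graph), nonnegative and satisfying the triangle inequality. For a set of edges $F$, $c(F)$ is the total weight of $F$. A 2-coloring here is an arbitrary partition of $V$ into blue nodes $V_b$ and red nodes $V_r$. *)

(* Defs.v *)
From HB Require Import structures.
From mathcomp Require Import all_boot all_order all_algebra.

Set Implicit Arguments.
Unset Strict Implicit.
Unset Printing Implicit Defensive.

Import Order.TTheory GRing.Theory Num.Theory.
Local Open Scope ring_scope.

Section WeightedTrees.

Variables (R : realFieldType) (V : finType).
Implicit Types (S : {set V}) (F : {set {set V}}) (c : {set V} -> R).

(* An edge is a two-element set of nodes; the values of a weight function
   [c : {set V} -> R] on sets of any other cardinality are irrelevant. *)
Definition metric c : Prop :=
  (forall x y : V, x != y -> 0 <= c [set x; y]) /\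
  (forall x y z : V, x != y -> y != z -> x != z ->
     c [set x; z] <= c [set x; y] + c [set y; z]).

Definition weight c F : R := \sum_(e in F) c e.

(* Since [c] is nonnegative on edges, this is the largest weight of an edge
   in [F], and it is 0 if [F] has no edge. *)
Definition heaviest_weight c F : R := \big[Num.max/0]_(e in F) c e.

Definition heaviest_edge c F (e : {set V}) : Prop :=
  e \in F /\ (forall f : {set V}, f \in F -> c f <= c e).

Definition edges_on S : {set {set V}} :=
  [set e : {set V} | (e \subset S) && (#|e| == 2)%N].

Definition adj F : rel V := [rel x y | (x != y) && ([set x; y] \in F)].

Definition connected_on S F : Prop :=
  forall x y : V, x \in S -> y \in S -> connect (adj F) x y.

Definition acyclic F : Prop :=
  forall s : seq V, ucycle (adj F) s -> (size s < 3)%N.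

(* If [S] is empty, the empty edge set is its only spanning tree. *)
Definition spanning_tree S F : Prop :=
  [/\ F \subset edges_on S, connected_on S F & acyclic F].

Definition min_spanning_tree c S F : Prop :=
  spanning_tree S F /\
  (forall F' : {set {set V}}, spanning_tree S F' -> weight c F <= weight c F').

Definition component_nodes F (x : V) : {set V} :=
  [set y | connect (adj F) x y].

Definition component_edges F (x : V) : {set {set V}} :=
  [set e in F | e \subset component_nodes F x].

Definition two_coloring (Vb Vr : {set V}) : Prop :=
  Vb :|: Vr = [set: V] /\ [disjoint Vb & Vr].

End WeightedTrees.

(* Main.v *)
Require Import Defs.
From HB Require Import structures.
From mathcomp Require Import all_boot all_order all_algebra.
From mathcomp Require Import lra.
Import Order.TTheory GRing.Theory Num.Theory.
Local Open Scope ring_scope.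

(* Every set [S] of nodes is spanned cheaply along a tree [F] rooted at [x]: by
   induction on [F], one connects the [S]-nodes of the subtrees through the tree
   edges and the triangle inequality, keeping track of the cost of joining the
   result to the root. If this joining is counted twice, an edge is used once when
   its parent is in [S] and twice otherwise. If it is counted once, every edge on
   one chosen path starting at the root is used only once. So the two colours
   together use an edge three times off the path and twice on it. For (a) and (b)
   the two sides of the heaviest edge are rooted at its ends, with paths through
   the heaviest edges of [TL] and [TR], and joined across it. For (c) and (d) the
   blue tree contains [TL] itself and the red nodes only need [TR]. *)

(** * Connectivity, cycles, and splitting a tree at an edge *)

Section Graphs.

Set Implicit Arguments.
Unset Strict Implicit.

Variable V : finType.
Implicit Types (S W A B : {set V}) (F H : {set {set V}}) (x y z u v r s : V).

Lemma adj_sym F : symmetric (adj F).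
Proof. by move=> x y; rewrite /adj /= eq_sym setUC. Qed.

Lemma connect_adjC F x y : connect (adj F) x y = connect (adj F) y x.
Proof. exact/sym_connect_sym/adj_sym. Qed.

Lemma sub_adj F H x y : F \subset H -> adj F x y -> adj H x y.
Proof. by move=> FH /andP[xy /(subsetP FH) h]; apply/andP. Qed.

Lemma sub_connect_adj F H x y :
  F \subset H -> connect (adj F) x y -> connect (adj H) x y.
Proof. by move=> FH; apply: connect_sub => u v /(sub_adj FH)/connect1. Qed.

Lemma acyclic_sub F H : F \subset H -> acyclic H -> acyclic F.
Proof.
move=> FH acH s /andP[cs us]; apply: acH; apply/andP; split=> //.
by apply: sub_cycle cs => u v; apply: sub_adj.
Qed.

Lemma edges_onS A B : A \subset B -> edges_on A \subset edges_on B.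
Proof.
move=> AB; apply/subsetP=> e; rewrite !inE => /andP[eA ->].
by rewrite (subset_trans eA AB).
Qed.

Lemma edge_ends S F x y :
  F \subset edges_on S -> [set x; y] \in F -> [/\ x \in S, y \in S & x != y].
Proof.
move=> /subsetP FS /FS; rewrite inE subUset !sub1set -andbA cards2.
by case/and3P=> -> ->; case: (x != y).
Qed.

Lemma adj_on S F x y :
  F \subset edges_on S -> adj F x y -> (x \in S) && (y \in S).
Proof. by move=> FS /andP[_ /(edge_ends FS)[-> ->]]. Qed.

Lemma connect_on S F x y :
  F \subset edges_on S -> x \in S -> connect (adj F) x y -> y \in S.
Proof.
move=> FS + /connectP[p]; elim: p x => [|z p IH] x /= Sx; first by move=> _ ->.
by case/andP=> /(adj_on FS)/andP[_ Sz] /IH; apply.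
Qed.

Lemma connect_star S F x :
  (forall y, y \in S -> connect (adj F) x y) -> connected_on S F.
Proof.
by move=> h u v /h xu /h; apply: connect_trans; rewrite connect_adjC.
Qed.

(* An edge lying on a cycle can be bypassed along the rest of the cycle. *)
Lemma connect_cycle_edge F x y z (t : seq V) :
  ucycle (adj F) [:: x, y, z & t] -> connect (adj (F :\ [set x; y])) x y.
Proof.
case/andP; rewrite /= => /and3P[_ yz pzt]; rewrite !inE !negb_or -!andbA.
case/andP=> xy /and3P[xz xt] /and3P[yz' yt _].
rewrite connect_adjC; apply: (@connect_trans _ _ z).
  apply: connect1; case/andP: yz => ? yzF; apply/andP; split=> //.
  rewrite in_setD1 yzF andbT; apply: contraNneq xz => e.
  have: z \in [set x; y] by rewrite -e !inE eqxx orbT.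
  by rewrite !inE eq_sym [z == y]eq_sym (negPf yz') orbF.
apply/connectP; exists (rcons t x); last by rewrite last_rcons.
(* After [z] the cycle never returns to [y], so no edge used here is [[set x; y]]. *)
apply: (@sub_in_path _ (predC1 y) (adj F)) pzt.
  move=> u v; rewrite !inE => uy vy /andP[uv uvF]; apply/andP; split=> //.
  rewrite in_setD1 uvF andbT; apply: contraTneq (set22 x y) => <-.
  by rewrite !inE negb_or eq_sym uy eq_sym.
apply/allP=> u; rewrite !inE mem_rcons !inE.
case/or3P=> [/eqP->|/eqP->|ut] //; first by rewrite eq_sym.
by apply: contraNneq yt => <-.
Qed.

(** An inclusion-minimal connected subset of [H] works: on a cycle with at least three nodes an edge
    could be bypassed, hence dropped. *)
Lemma connected_spanning_tree S H :
  H \subset edges_on S -> connected_on S H ->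
  exists2 F : {set {set V}}, F \subset H & spanning_tree S F.
Proof.
move=> HS coH.
pose conn F := [forall x in S, forall y in S, connect (adj F) x y].
have connP F : reflect (connected_on S F) (conn F).
  apply: (iffP forall_inP) => [h x y Sx Sy|h x Sx].
    by move/forall_inP: (h x Sx); apply.
  by apply/forall_inP=> y; apply: h.
have /minset_exists[F /minsetP[/connP coF minF] FH] : conn H by apply/connP.
exists F => //; split=> //; first exact: subset_trans FH HS.
case=> [|x [|y [|z t]]] // cyc; exfalso.
have exy : connect (adj (F :\ [set x; y])) x y by apply: connect_cycle_edge cyc.
have xyF : [set x; y] \in F by case/andP: cyc => /andP[/andP[]].
have: [set x; y] \in F :\ [set x; y]; last by rewrite !inE eqxx.
rewrite (minF (F :\ [set x; y])) ?subD1set //; apply/connP=> a b Sa Sb.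
apply: connect_sub (coF a b Sa Sb) => u v /andP[uv uvF].
have [e|ne] := eqVneq [set u; v] [set x; y].
  have: u \in [set x; y] by rewrite -e set21.
  have: v \in [set x; y] by rewrite -e set22.
  rewrite !inE => /orP[]/eqP-> /orP[]/eqP-> //.
  by rewrite connect_adjC.
by apply: connect1; rewrite /adj /= uv !inE ne.
Qed.

(** A simple path avoiding the edge would close up with it to a cycle. *)
Lemma tree_edge_separates S F x y :
  spanning_tree S F -> [set x; y] \in F ->
  ~~ connect (adj (F :\ [set x; y])) x y.
Proof.
case=> FS _ acF xyF; have [_ _ xy] := edge_ends FS xyF.
apply/negP=> /connectP[p0 /shortenP[p pp up _] ey].
have : ucycle (adj F) (x :: p).
  rewrite /ucycle up andbT /= rcons_path -ey adj_sym /adj /= xy xyF /= andbT.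
  by apply: sub_path pp => u v; apply: sub_adj; apply: subD1set.
(* Acyclicity leaves only paths of length at most one: the empty one gives [x = y], the other would
   use the deleted edge. *)
move/acF; case: p pp up ey => [|z [|? ?]] //= => [_ _ e|].
  by rewrite e eqxx in xy.
by rewrite andbT => + _ e; rewrite -e /adj /= !inE eqxx /= andbF.
Qed.

Lemma component_connected F x :
  connected_on (component_nodes F x) (component_edges F x).
Proof.
apply: (@connect_star _ _ x) => y; rewrite inE => /connectP[p pp ->].
have: connect (adj F) x x by [].
elim: p {-2 4}x pp => [|z p IH] u //= /andP[uz pz] xu.
have xz : connect (adj F) x z by apply: connect_trans xu (connect1 uz).
apply: connect_trans (IH z pz xz); apply: connect1.
case/andP: uz => uz uzF; rewrite /adj /= uz !inE uzF /=.
by apply/subsetP=> v; rewrite !inE => /orP[]/eqP->.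
Qed.

Lemma component_tree S F x :
  F \subset edges_on S -> acyclic F ->
  spanning_tree (component_nodes F x) (component_edges F x).
Proof.
move=> FS acF; split; last 1 first.
- by apply: acyclic_sub acF; apply/subsetP=> e; rewrite inE => /andP[].
- apply/subsetP=> e; rewrite !inE => /andP[/(subsetP FS) + ->].
  by rewrite inE => /andP[].
- exact: component_connected.
Qed.

(** Along a path from [x] in [F], a step either stays in its component or crosses the deleted edge
    and so lands on [x] or [y]. *)
Lemma tree_edge_cover S F x y :
  spanning_tree S F -> [set x; y] \in F ->
  S = component_nodes (F :\ [set x; y]) x
      :|: component_nodes (F :\ [set x; y]) y.
Proof.
case=> FS coF acF xyF; have [Sx Sy xy] := edge_ends FS xyF.
have F'S := subset_trans (subD1set F [set x; y]) FS.
apply/setP=> z; rewrite !inE; apply/idP/orP; last first.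
  by case; apply: connect_on F'S _.
move=> /(coF x z Sx)/connectP[p pp ->].
suff main w : path (adj F) w p ->
    connect (adj (F :\ [set x; y])) x w \/ connect (adj (F :\ [set x; y])) y w ->
    connect (adj (F :\ [set x; y])) x (last w p)
      \/ connect (adj (F :\ [set x; y])) y (last w p).
  by apply: main pp _; left.
elim: p w {pp} => [|v p IH] u //= /andP[uv pv] xyu; apply: (IH v pv).
have [e|ne] := eqVneq [set u; v] [set x; y].
  have: v \in [set x; y] by rewrite -e set22.
  by rewrite !inE => /orP[]/eqP->; [left|right].
have uv' : adj (F :\ [set x; y]) u v.
  by case/andP: uv => uv uvF; rewrite /adj /= uv !inE ne.
by case: xyu => h; [left|right]; apply: connect_trans h (connect1 uv').
Qed.

Lemma tree_edge_disjoint S F x y :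
  spanning_tree S F -> [set x; y] \in F ->
  [disjoint component_nodes (F :\ [set x; y]) x
          & component_nodes (F :\ [set x; y]) y].
Proof.
move=> trF xyF; rewrite -setI_eq0; apply/eqP/setP=> z; rewrite !inE.
apply/negP=> /andP[xz yz]; case/negP: (tree_edge_separates trF xyF).
by apply: connect_trans xz _; rewrite connect_adjC.
Qed.

Lemma edgeP S e : e \in edges_on S -> exists x y, e = [set x; y].
Proof. by rewrite inE => /andP[_ /cards2P[x [y [_ ->]]]]; exists x, y. Qed.

Lemma tree_edges_split S F x y :
  spanning_tree S F -> [set x; y] \in F ->
  F :\ [set x; y] = component_edges (F :\ [set x; y]) x
                    :|: component_edges (F :\ [set x; y]) y.
Proof.
move=> trF xyF; have [FS _ _] := trF; set F' := F :\ _.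
have compE w u v : [set u; v] \in F' -> connect (adj F') w u ->
    [set u; v] \in component_edges F' w.
  move=> uvF' wu; rewrite inE uvF'; apply/subsetP=> a.
  have [|_ _ uv] := @edge_ends S F u v FS; first by case/setD1P: uvF'.
  rewrite !inE => /orP[]/eqP-> //; apply: connect_trans wu (connect1 _).
  by rewrite /adj /= uv.
apply/eqP; rewrite eqEsubset; apply/andP; split; apply/subsetP=> e; last first.
  by rewrite /component_edges; case/setUP=> /setIdP[].
move=> eF'; have eF : e \in F by case/setD1P: eF'.
have [u [v euv]] := edgeP (subsetP FS _ eF); rewrite {e}euv in eF' eF *.
have [Su _ _] := edge_ends FS eF.
move: Su; rewrite {1}(tree_edge_cover trF xyF) => /setUP[]; rewrite inE => h.
  by apply/setUP; left; apply: compE.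
by apply/setUP; right; apply: compE.
Qed.

Lemma component_edges_disjoint F x y :
  F \subset edges_on [set: V] ->
  [disjoint component_nodes F x & component_nodes F y] ->
  [disjoint component_edges F x & component_edges F y].
Proof.
move=> FT dxy; rewrite -setI_eq0; apply/eqP/setP=> e; rewrite !inE.
apply/negP=> /andP[/andP[eF ex] /andP[_ ey]].
have [u [v euv]] := edgeP (subsetP FT _ eF).
have ue : u \in e by rewrite euv set21.
by have := disjointFr dxy (subsetP ex _ ue); rewrite (subsetP ey _ ue).
Qed.

Lemma tree_root_edge S F x f :
  spanning_tree S F -> x \in S -> f \in F -> exists y, [set x; y] \in F.
Proof.
case=> FS coF _ Sx fF.
have [u [v euv]] := edgeP (subsetP FS _ fF).
rewrite euv in fF; have [Su Sv uv] := edge_ends FS fF.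
have [eux|xu] := eqVneq u x; first by exists v; rewrite -eux.
have /connectP[[|y p] /=] := coF x u Sx Su.
  by move=> _ e; rewrite e eqxx in xu.
by case/andP=> /andP[_ xyF] _ _; exists y.
Qed.

Lemma singleton_tree W x : spanning_tree W set0 -> x \in W -> W = [set x].
Proof.
move=> [_ co _] Wx; apply/setP=> y; rewrite inE; apply/idP/eqP=> [Wy|-> //].
have /connectP[[|z p] /=] := co x y Wx Wy; first by move=> _ ->.
by rewrite /adj /= inE andbF.
Qed.

Lemma component_edges_card F e x :
  e \in F -> (#|component_edges (F :\ e) x| < #|F|)%N.
Proof.
move=> eF; apply: proper_card; apply/properP; split.
  by apply/subsetP=> f; rewrite !inE => /andP[/andP[]].
by exists e => //; rewrite !inE eqxx.
Qed.

Lemma tree_split_tree S F e x :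
  spanning_tree S F ->
  spanning_tree (component_nodes (F :\ e) x) (component_edges (F :\ e) x).
Proof.
case=> FS _ acF; apply: component_tree (acyclic_sub (subD1set _ _) acF).
exact: subset_trans (subD1set _ _) FS.
Qed.

Lemma component_root F x : x \in component_nodes F x.
Proof. by rewrite inE. Qed.

End Graphs.

(** * Weights of edge sets, and distances between nodes *)

Section Weights.

Set Implicit Arguments.
Unset Strict Implicit.

Variables (R : realFieldType) (V : finType) (c : {set V} -> R).
Hypothesis c_metric : metric c.
Implicit Types (S W A B : {set V}) (F H : {set {set V}}) (x y z u v r s : V).

Lemma edge_ge0 S F e : F \subset edges_on S -> e \in F -> 0 <= c e.
Proof.
move=> FS eF; have [x [y exy]] := edgeP (subsetP FS _ eF).
rewrite exy in eF *; have [_ _ xy] := edge_ends FS eF.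
exact: c_metric.1.
Qed.

Lemma weight_sub S F H :
  H \subset edges_on S -> F \subset H -> weight c F <= weight c H.
Proof.
move=> HS FH; rewrite /weight [leRHS](big_setID F) /= (setIidPr FH) lerDl.
by apply: sumr_ge0 => e /setDP[eH _]; apply: edge_ge0 HS eH.
Qed.

Lemma weight_ge0 S F : F \subset edges_on S -> 0 <= weight c F.
Proof. by move=> FS; apply: sumr_ge0 => e; apply: edge_ge0 FS. Qed.

Lemma weightU S F H :
  H \subset edges_on S -> weight c (F :|: H) <= weight c F + weight c H.
Proof.
move=> HS; rewrite /weight [leLHS](big_setID F) /= setUK lerD2l setDUl setDv set0U.
exact: weight_sub HS (subsetDl _ _).
Qed.

(** Thanks to this, an upper bound on a minimum spanning tree only needs a connected edge set,
    possibly with cycles. *)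
Lemma mst_le S F H :
  min_spanning_tree c S F -> H \subset edges_on S -> connected_on S H ->
  weight c F <= weight c H.
Proof.
move=> [_ minF] HS /(connected_spanning_tree HS)[F' F'H /minF leF].
exact: le_trans leF (weight_sub HS F'H).
Qed.

Lemma weight_tree_split S F x y :
  spanning_tree S F -> [set x; y] \in F ->
  weight c F = c [set x; y] + weight c (component_edges (F :\ [set x; y]) x)
               + weight c (component_edges (F :\ [set x; y]) y).
Proof.
move=> trF xyF; have [FS _ _] := trF.
rewrite /weight (big_setD1 _ xyF) /= -addrA; congr (_ + _).
rewrite {1}(tree_edges_split trF xyF) -bigU //=.
  by apply: eq_bigl => e; rewrite !in_setU.
apply: component_edges_disjoint (tree_edge_disjoint trF xyF).
apply: subset_trans (subD1set _ _) (subset_trans FS _).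
exact/edges_onS/subsetT.
Qed.

(** [metric] says nothing about [c] on singletons; the value 0 on the diagonal lets a root coincide
    with a chosen node. *)
Definition dist x y : R := if x == y then 0 else c [set x; y].

Lemma distxx x : dist x x = 0.
Proof. by rewrite /dist eqxx. Qed.

Lemma dist_ge0 x y : 0 <= dist x y.
Proof. by rewrite /dist; case: eqVneq => // /(c_metric.1). Qed.

Lemma distC x y : dist x y = dist y x.
Proof. by rewrite /dist eq_sym setUC. Qed.

Lemma dist_triangle x y z : dist x z <= dist x y + dist y z.
Proof.
have [->|xy] := eqVneq x y; first by rewrite distxx add0r.
have [->|yz] := eqVneq y z; first by rewrite distxx addr0.
have [->|xz] := eqVneq x z.
  by rewrite distxx addr_ge0 ?dist_ge0.
by rewrite /dist (negPf xy) (negPf yz) (negPf xz); apply: c_metric.2.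
Qed.

Lemma dist_triangle3 r x y s : dist r s <= dist x r + dist x y + dist y s.
Proof.
have := dist_triangle r x s; have := dist_triangle x y s.
by rewrite (distC r x); lra.
Qed.

(** * Connecting the nodes of one class and joining them to a root *)

Lemma connected_glue A B H1 H2 r s :
  H1 \subset edges_on A -> connected_on A H1 ->
  H2 \subset edges_on B -> connected_on B H2 ->
  r \in A -> s \in B ->
  exists H : {set {set V}}, [/\ H \subset edges_on (A :|: B),
    connected_on (A :|: B) H
    & weight c H <= weight c H1 + weight c H2 + dist r s].
Proof.
move=> H1A co1 H2B co2 Ar Bs.
have A1 : H1 \subset edges_on (A :|: B).
  exact: subset_trans H1A (edges_onS (subsetUl _ _)).
have B2 : H2 \subset edges_on (A :|: B).
  exact: subset_trans H2B (edges_onS (subsetUr _ _)).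
(* If [r = s], the singleton [[set r; s]] is not an edge, and nothing has to be added. *)
pose E : {set {set V}} := if r == s then set0 else [set [set r; s]].
have EAB : E \subset edges_on (A :|: B).
  rewrite /E; case: eqVneq => [_|rs]; first exact: sub0set.
  rewrite sub1set inE cards2 rs andbT; apply/subsetP=> z.
  by rewrite !inE => /orP[]/eqP->; rewrite ?Ar ?Bs ?orbT.
have wE : weight c E = dist r s.
  by rewrite /E /dist /weight; case: eqP => _; rewrite ?big_set0 ?big_set1.
exists (H1 :|: H2 :|: E); split.
- by rewrite !subUset A1 B2.
- have rs : connect (adj (H1 :|: H2 :|: E)) r s.
    have [->//|rs] := eqVneq r s; apply: connect1.
    by rewrite /adj /= rs /E (negPf rs) !inE eqxx orbT.
  apply: (@connect_star _ _ _ r) => z /setUP[Az|Bz].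
    by apply: sub_connect_adj (co1 r z Ar Az); rewrite -setUA subsetUl.
  apply: connect_trans rs _; apply: sub_connect_adj (co2 s z Bs Bz).
  by rewrite setUAC subsetUr.
- by rewrite -wE; have := weightU (H1 :|: H2) EAB; have := weightU H1 B2; lra.
Qed.

(* [S]-nodes of [W] can be connected among themselves, and one of them joined
   to the root [x] by [m] parallel edges, at total cost at most [k]. *)
Definition reach S W x (m k : R) : Prop :=
  exists H : {set {set V}}, [/\ H \subset edges_on (S :&: W),
    connected_on (S :&: W) H, weight c H <= k
    & S :&: W != set0 ->
      exists2 r, r \in S :&: W & weight c H + m * dist x r <= k].

Lemma reach_le S W x m m' k :
  m' <= m -> reach S W x m k -> reach S W x m' k.
Proof.
move=> lem [H [HS coH wH hr]]; exists H; split=> // /hr[r Sr le].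
by exists r => //; apply: le_trans le; rewrite lerD2l ler_wpM2r ?dist_ge0.
Qed.

(** The root can serve as its own representative at distance 0, so the multiplicity may even
    grow. *)
Lemma reach_root S W x m m' k :
  x \in S :&: W -> reach S W x m k -> reach S W x m' k.
Proof.
move=> Sx [H [HS coH wH _]]; exists H; split=> // _.
by exists x; rewrite // distxx mulr0 addr0.
Qed.

Lemma reach_join_near S W1 W2 x y m k1 k2 :
  0 <= m -> (m <= 1) || (S :&: W1 != set0) ->
  reach S W1 x (m + 1) k1 -> reach S W2 y 1 k2 ->
  reach S (W1 :|: W2) x m (k1 + k2 + dist x y).
Proof.
move=> m0 mW [H1 [H1S co1 wH1 hr]] [H2 [H2S co2 wH2 hs]].
have e0 := dist_ge0 x y; have := weight_ge0 H1S; have := weight_ge0 H2S.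
move=> w2 w1; rewrite /reach setIUr.
(* Without [S]-nodes in [W1] the root must be reached from [s] through [y], and [dist x y] is
   available only once; hence [m <= 1] here. *)
have [E1|N1] := eqVneq (S :&: W1) set0.
  rewrite E1 set0U; exists H2; split=> //; first by lra.
  case/hs=> s Ss le; exists s => //.
  rewrite E1 eqxx orbF in mW; have := dist_triangle x y s.
  have : m * dist x s <= dist x s by rewrite ler_piMl ?dist_ge0.
  by lra.
have [r Sr ler] := hr N1.
have mr : 0 <= m * dist x r by rewrite mulr_ge0 ?dist_ge0.
have r0 := dist_ge0 x r.
have [E2|N2] := eqVneq (S :&: W2) set0.
  rewrite E2 setU0; exists H1; split=> //; first by lra.
  by move=> _; exists r => //; lra.
have [s Ss les] := hs N2; have tri := dist_triangle3 r x y s.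
have [H [HS coH wH]] := connected_glue H1S co1 H2S co2 Sr Ss.
have s0 := dist_ge0 y s.
exists H; split=> //; first by lra.
by move=> _; exists r; [rewrite inE Sr|lra].
Qed.

(** Paying [dist x y] twice lets the multiplicity at [x] stay [m]: the new representative is
    whichever of [r] and [s] has the cheaper way to the root. *)
Lemma reach_join_far S W1 W2 x y m k1 k2 :
  1 <= m <= 2 -> reach S W1 x m k1 -> reach S W2 y 2 k2 ->
  reach S (W1 :|: W2) x m (k1 + k2 + 2 * dist x y).
Proof.
move=> /andP[m1 m2] [H1 [H1S co1 wH1 hr]] [H2 [H2S co2 wH2 hs]].
have e0 := dist_ge0 x y; have := weight_ge0 H1S; have := weight_ge0 H2S.
move=> w2 w1; rewrite /reach setIUr.
have [E1|N1] := eqVneq (S :&: W1) set0.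
  rewrite E1 set0U; exists H2; split=> //; first by lra.
  case/hs=> s Ss le; exists s => //; have := dist_triangle x y s.
  have : m * dist x s <= 2 * dist x s by rewrite ler_wpM2r ?dist_ge0.
  by lra.
have [r Sr ler] := hr N1.
have r0 := dist_ge0 x r.
have mr : dist x r <= m * dist x r by rewrite ler_peMl.
have [E2|N2] := eqVneq (S :&: W2) set0.
  rewrite E2 setU0; exists H1; split=> //; first by lra.
  by move=> _; exists r => //; lra.
have [s Ss les] := hs N2; have tri := dist_triangle3 r x y s.
have [H [HS coH wH]] := connected_glue H1S co1 H2S co2 Sr Ss.
have s0 := dist_ge0 y s; have tri' := dist_triangle x y s.
exists H; split=> //; first by lra.
(* With [a] and [b] the two sides compared, the budget beyond the two weights is [m * a + 2 * b] and
   gluing costs [a + b]. What remains is [(m - 1) * a + b], which covers [m] times the smaller of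
   [a] and [b]. *)
move=> _; have [le|lt] := leP (dist x r) (dist x y + dist y s).
  by exists r; [rewrite inE Sr|lra].
exists s; first by rewrite inE Ss orbT.
have : m * dist x s <= m * (dist x y + dist y s) by rewrite ler_wpM2l //; lra.
have : (m - 1) * (dist x y + dist y s) <= (m - 1) * dist x r.
  by rewrite ler_wpM2l ?subr_ge0 // ltW.
by lra.
Qed.

(* One bound [k] per colour class. An edge of the rooted tree is paid once by
   a class containing its parent and twice by any other class, so two classes
   covering [V] pay it at most three times. *)
Definition reach_bounds W F x (m h : R) : Prop :=
  exists k : {set V} -> R, [/\ forall S, reach S W x m (k S),
    forall S, k S <= 2 * weight c F - h
    & forall S S', S :|: S' = [set: V] -> k S + k S' <= 3 * weight c F - h].

(** * Combining the bounds of two subtrees, and induction on rooted trees *)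

Lemma reach_bounds_join_far W1 W2 F1 F2 F x y m h1 h2 :
  1 <= m <= 2 -> x \in W1 ->
  weight c F = dist x y + weight c F1 + weight c F2 ->
  reach_bounds W1 F1 x m h1 -> reach_bounds W2 F2 y 2 h2 ->
  reach_bounds (W1 :|: W2) F x m (h1 + h2).
Proof.
move=> m12 W1x wF [k1 [r1 b1 d1]] [k2 [r2 b2 d2]].
have e0 := dist_ge0 x y.
exists (fun S => k1 S + k2 S + (if x \in S then 1 else 2) * dist x y); split.
- move=> S; case: ifP => Sx; last exact: reach_join_far.
  (* As [x] is in [S], the side of [x] offers multiplicity [m + 1] for free, so the edge is paid
     once. *)
  rewrite mul1r; have Sx' : x \in S :&: W1 by rewrite inE Sx.
  apply: reach_join_near; first by lra.
  + by apply/orP; right; apply/set0Pn; exists x.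
  + exact: reach_root Sx' (r1 S).
  + by apply: reach_le (r2 S); lra.
- by move=> S; have := b1 S; have := b2 S; case: ifP => _; lra.
- move=> S S' dS; have := d1 _ _ dS; have := d2 _ _ dS.
  have : x \in S :|: S' by rewrite dS.
  by rewrite inE; case: (x \in S); case: (x \in S') => // _; lra.
Qed.

(** Every class pays the edge once: one class saves one of two copies, a pair one of three, so the
    saving grows by [dist x y]. The side of [y] needs only multiplicity 1, so savings can continue
    there. *)
Lemma reach_bounds_join_near W1 W2 F1 F2 F x y h1 h2 :
  weight c F = dist x y + weight c F1 + weight c F2 ->
  reach_bounds W1 F1 x 2 h1 -> reach_bounds W2 F2 y 1 h2 ->
  reach_bounds (W1 :|: W2) F x 1 (h1 + h2 + dist x y).
Proof.
move=> wF [k1 [r1 b1 d1]] [k2 [r2 b2 d2]]; have e0 := dist_ge0 x y.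
exists (fun S => k1 S + k2 S + dist x y); split.
- by move=> S; apply: reach_join_near; rewrite ?lexx ?ler01.
- by move=> S; have := b1 S; have := b2 S; lra.
- by move=> S S' dS; have := d1 _ _ dS; have := d2 _ _ dS; lra.
Qed.

Lemma reach_bounds_le W F x m m' h :
  m' <= m -> reach_bounds W F x m h -> reach_bounds W F x m' h.
Proof.
by move=> le [k [r b d]]; exists k; split=> // S; apply: reach_le (r S).
Qed.

Lemma weight_tree_dist S F x y :
  spanning_tree S F -> [set x; y] \in F ->
  weight c F = dist x y + weight c (component_edges (F :\ [set x; y]) x)
               + weight c (component_edges (F :\ [set x; y]) y).
Proof.
move=> trF xyF; have [FS _ _] := trF; have [_ _ xy] := edge_ends FS xyF.
by rewrite (weight_tree_split trF xyF) /dist (negPf xy).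
Qed.

(** Cutting an edge at the root leaves two smaller trees, rooted at its ends, to which induction
    applies. *)
Lemma tree_reach2 W F x :
  spanning_tree W F -> x \in W -> reach_bounds W F x 2 0.
Proof.
have [n] := ubnP #|F|; elim: n => // n IH in W F x *; rewrite ltnS => Fn trF Wx.
have [F0|[f fF]] := set_0Vmem F.
  rewrite F0 in trF *; exists (fun=> 0); rewrite /weight big_set0.
  split=> [S|S|S S' _]; [|by lra|by lra].
  have WE := singleton_tree trF Wx.
  exists set0; split; first exact: sub0set.
  - move=> u v; rewrite WE !inE => /andP[_ /eqP->] /andP[_ /eqP->].
    exact: connect0.
  - by rewrite /weight big_set0.
  case/set0Pn=> z; rewrite WE => zS; exists z => //.
  case/setIP: zS => _ /set1P->.
  by rewrite /weight big_set0 distxx; lra.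
have [y xyF] := tree_root_edge trF Wx fF.
rewrite (tree_edge_cover trF xyF) -[0]addr0.
apply: (reach_bounds_join_far _ _ (weight_tree_dist trF xyF)).
- by lra.
- exact: component_root.
- apply: IH (tree_split_tree _ _ trF) (component_root _ _).
  exact: leq_trans (component_edges_card _ xyF) Fn.
- apply: IH (tree_split_tree _ _ trF) (component_root _ _).
  exact: leq_trans (component_edges_card _ xyF) Fn.
Qed.

(* The edges on the path from the root to [f] are paid only once per class. *)
Lemma tree_reach1 W F x f :
  spanning_tree W F -> x \in W -> f \in F -> reach_bounds W F x 1 (c f).
Proof.
have [n] := ubnP #|F|; elim: n => // n IH in W F x *; rewrite ltnS => Fn trF Wx fF.
have [y xyF] := tree_root_edge trF Wx fF.
have [FW _ _] := trF; have [_ _ xy] := edge_ends FW xyF.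
have wF := weight_tree_dist trF xyF.
have tr z := tree_split_tree [set x; y] z trF.
have closed z := tree_reach2 (tr z) (component_root _ _).
have open z := IH _ _ z (leq_trans (component_edges_card z xyF) Fn) (tr z)
                 (component_root _ _).
rewrite (tree_edge_cover trF xyF).
(* The edge [f] is the cut edge itself, or lies on the side of [x], or on the side of [y]. In the
   last case the cut edge is on the path, and its extra saving is discarded. *)
have [->|fxy] := eqVneq f [set x; y].
  have := reach_bounds_join_near wF (closed x)
    (reach_bounds_le (ler1n _ 2) (closed y)).
  by rewrite !add0r /dist (negPf xy).
have: f \in F :\ [set x; y] by rewrite !inE fxy.
rewrite {1}(tree_edges_split trF xyF) => /setUP[fx|fy].
  rewrite -[c f]addr0.
  apply: (reach_bounds_join_far _ _ wF (open x fx) (closed y)).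
    by lra.
  exact: component_root.
have [k [r b d]] := reach_bounds_join_near wF (closed x) (open y fy).
have e0 := dist_ge0 x y.
exists k; split=> // [S|S S' dS].
  by have := b S; lra.
by have := d _ _ dS; lra.
Qed.

Lemma tree_reach_heaviest W F x :
  spanning_tree W F -> x \in W -> reach_bounds W F x 1 (heaviest_weight c F).
Proof.
move=> trF Wx; have [FW _ _] := trF; have [F0|[f0 f0F]] := set_0Vmem F.
  rewrite /heaviest_weight {2}F0 big_set0.
  exact: reach_bounds_le (ler1n _ 2) (tree_reach2 trF Wx).
have [f fF fmax] := @arg_maxP _ _ _ f0 (mem F) c f0F.
(* The maximum starts from the default 0, so [0 <= c f] is needed as well. *)
have hf : heaviest_weight c F <= c f.
  by apply: bigmax_le; [apply: edge_ge0 FW fF|move=> e; apply: fmax].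
have [k [r b d]] := tree_reach1 trF Wx fF.
exists k; split=> // [S|S S' dS].
  by have := b S; lra.
by have := d _ _ dS; lra.
Qed.

End Weights.

(** * Applying the bounds on both sides of the deleted edge *)

Theorem theorem1 (R : realFieldType) (V : finType) (c : {set V} -> R)
    (T Tb Tr : {set {set V}}) (Vb Vr : {set V}) (vL vR : V)
    (VL : {set V}) (TL TR : {set {set V}}) (wX wL wR : R)
    (c_metric : metric c)
    (T_mst : min_spanning_tree c [set: V] T)
    (V_coloring : two_coloring Vb Vr)
    (Tb_mst : min_spanning_tree c Vb Tb)
    (Tr_mst : min_spanning_tree c Vr Tr)
    (eX_heaviest : heaviest_edge c T [set vL; vR])
    (wX_def : wX = c [set vL; vR])
    (VL_def : VL = component_nodes (T :\ [set vL; vR]) vL)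
    (TL_def : TL = component_edges (T :\ [set vL; vR]) vL)
    (TR_def : TR = component_edges (T :\ [set vL; vR]) vR)
    (wL_def : wL = heaviest_weight c TL)
    (wR_def : wR = heaviest_weight c TR) :
  [/\ weight c Tb + weight c Tr <= 3 * weight c T - (wL + wX + wR),
      Num.max (weight c Tb) (weight c Tr) <= 2 * weight c T - (wL + wX + wR)
    & VL \subset Vb ->
        weight c Tb + weight c Tr
          <= weight c TL + wX + (3 * weight c TR - wR) /\
        Num.max (weight c Tb) (weight c Tr)
          <= weight c TL + wX + (2 * weight c TR - wR)].
Proof.
have [trT _] := T_mst; have [cbr dbr] := V_coloring; have [eT _] := eX_heaviest.
have wT := weight_tree_dist c trT eT.
have VE := tree_edge_cover trT eT; have VD := tree_edge_disjoint trT eT.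
have trL := tree_split_tree [set vL; vR] vL trT.
have trR := tree_split_tree [set vL; vR] vR trT.
have [TT _ _] := trT; have [_ _ LR] := edge_ends TT eT.
have wXE : wX = dist c vL vR by rewrite wX_def /dist (negPf LR).
have vLL := component_root (T :\ [set vL; vR]) vL.
have vRR := component_root (T :\ [set vL; vR]) vR.
set VR := component_nodes _ vR in VE VD trR vRR.
rewrite -TL_def -TR_def -wXE in wT; rewrite -TL_def -VL_def in trL.
rewrite -VL_def in VE VD vLL; rewrite -TR_def in trR.
have [kL [rL bL dL]] := tree_reach_heaviest c_metric trL vLL.
have [kR [rR bR dR]] := tree_reach_heaviest c_metric trR vRR.
rewrite -wL_def in bL dL; rewrite -wR_def in bR dR.
(* No further root has to be reached, so the two sides are joined with [m = 0]: multiplicity 1 on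
   each side suffices, and each class pays [wX] once. *)
have mst S F k1 k2 : min_spanning_tree c S F ->
    reach c S VL vL 1 k1 -> reach c S VR vR 1 k2 -> weight c F <= k1 + k2 + wX.
  move=> mstF r1 r2.
  have := @reach_join_near _ _ _ c_metric S VL VR vL vR 0 k1 k2.
  rewrite add0r -VE -wXE ler01 => /(_ (lexx _) isT r1 r2)[H [HS coH wH _]].
  rewrite setIT in HS coH; exact: le_trans (mst_le c_metric mstF HS coH) wH.
have bb := mst _ _ _ _ Tb_mst (rL Vb) (rR Vb).
have rr := mst _ _ _ _ Tr_mst (rL Vr) (rR Vr).
split.
- by have := dL _ _ cbr; have := dR _ _ cbr; lra.
- rewrite ge_max; have := bL Vb; have := bL Vr; have := bR Vb; have := bR Vr.
  by move=> *; apply/andP; split; lra.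
move=> VLb; have [TLV coL _] := trL.
(* [TL] already connects the all-blue [VL], and its root [vL] is blue, so joining is free. *)
have rLb : reach c Vb VL vL 1 (weight c TL).
  exists TL; rewrite (setIidPr VLb); split=> // _.
  by exists vL; rewrite // distxx mulr0 addr0.
have {}bb := mst _ _ _ _ Tb_mst rLb (rR Vb).
(* All red nodes lie in [VR], so the red tree never pays for [TL] or the crossing edge. *)
have {}rr : weight c Tr <= kR Vr.
  have [H [HS coH wH _]] := rR Vr.
  have VrE : Vr :&: VR = Vr.
    apply/setIidPl/subsetP=> z zr; have: z \in [set: V] by [].
    rewrite VE => /setUP[/(subsetP VLb) zb|//].
    by rewrite (disjointFr dbr zb) in zr.
  rewrite VrE in HS coH; exact: le_trans (mst_le c_metric Tr_mst HS coH) wH.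
(* These signs are for the red half of the maximum in (d), whose bound lacks both terms. *)
have wL0 := weight_ge0 c_metric TLV.
have wX0 : 0 <= wX by rewrite wXE; apply: dist_ge0.
split; first by have := dR _ _ cbr; lra.
rewrite ge_max; have := bR Vb; have := bR Vr.
by move=> *; apply/andP; split; lra.
Qed.
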